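(* Let $n\in\mathbb{N}$. As meromorphic functions of $s\in\mathbb{C}$, $$\zeta_{\mathbb{S}^{2n-1}_+}(s,\lambda_{2n-1})=\frac12\sum_{i=1}^{n}\bar u(n-1,i-1)\Big[\zeta(2s-2i+2)-(n-1)\zeta(2s-2i+3)\Big],$$ $$\zeta_{\mathbb{S}^{2n}_+}(s,\lambda_{2n})=\sum_{i=1}^{n}\bar v(n,i)\Big[\left(2^{2s-1}-2^{2i-2}\right)\zeta(2s-2i+1)-(2n-1)\left(2^{2s-1}-2^{2i-3}\right)\zeta(2s-2i+2)\Big].$$
   Context: $\mathbb{N}=\{1,2,3,\dots\}$ and $\zeta(s)$ is the Riemann zeta function. For $N\ge1$ and $\lambda_N=\left(\frac{N-1}{2}\right)^2$, the shifted zeta function of the $N$-dimensional hemisphere $\mathbb{S}^N_+$ with Dirichlet boundary conditions (whose Laplace eigenvalues are $k(k+N-1)$, $k\ge1$, with multiplicities $\binom{N+k-2}{k-1}$) is $\zeta_{\mathbb{S}^N_+}(s,\lambda_N):=\sum_{k=1}^\infty\binom{N+k-2}{k-1}\left(k+\frac{N-1}{2}\right)^{-2s}$ for $\mathrm{Re}(s)$ large, extended meromorphically to $\mathbb{C}$. The central factorial numbers are given for $n\ge1$ by $\sum_{k=1}^nu(n,k)x^k=\prod_{i=0}^{n-1}(x-i^2)$ and $\sum_{k=1}^nv(n,k)x^k=x\prod_{i=1}^{n-1}\big(x-(2i-1)^2\big)$, with $u(n,0)=0$ for $n\ge1$ and $u(0,0)=1$; moreover $\bar u(n,k):=\frac{2}{(2n)!}u(n,k)$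 (so $\bar u(0,0)=2$) and $\bar v(n,k):=\frac{4^{-(n-1)}}{(2n-1)!}v(n,k)$. *)

(* Defs.v *)
From Stdlib Require Import Reals List Factorial.
From Coquelicot Require Import Coquelicot.

Open Scope R_scope.

(** [cpow x s] is [x ^ s = exp (s * ln x)] for a real base [x > 0]. *)
Definition cpow (x : R) (s : C) : C :=
  (Rpower x (Re s) * cos (Im s * ln x), Rpower x (Re s) * sin (Im s * ln x)).

(** Meromorphic on the whole plane: around every [z0], [f] is the sum of a
    Laurent series with finite principal part.  The value of [f] at [z0] itself
    is unconstrained, since [f] is total and may have a pole there. *)
Definition meromorphic (f : C -> C) : Prop :=
  forall z0 : C, exists (m : nat) (a : nat -> C),
    locally' z0 (fun z : C =>
      @is_pseries C_AbsRing C_NormedModule a (z - z0)%C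
        (@pow_n C_AbsRing (z - z0)%C m * f z)%C).

(** Equality of meromorphic functions, i.e. up to the values taken on a closed
    discrete set. *)
Definition mero_eq (f g : C -> C) : Prop :=
  forall z0 : C, locally' z0 (fun z : C => f z = g z).

(** [f] is a meromorphic extension to [C] of the series of functions
    [a 1 + a 2 + a 3 + ...], which is required to converge for [Re s > sigma]. *)
Definition meromorphic_extension (sigma : R) (a : nat -> C -> C) (f : C -> C)
  : Prop :=
  meromorphic f /\
  forall s : C, sigma < Re s ->
    @is_series C_AbsRing C_NormedModule (fun j : nat => a (S j) s) (f s).

Definition is_riemann_zeta (zeta : C -> C) : Prop :=
  meromorphic_extension 1 (fun k s => cpow (INR k) (- s)%C) zeta.

(** [Binomial.C] is the real-valued binomial coefficient; no subtraction below
    is truncated, since [N >= 1] and [k >= 1]. *)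
Definition hemisphere_term (N k : nat) (s : C) : C :=
  (RtoC (Binomial.C (N + k - 2) (k - 1))
   * cpow (INR k + (INR N - 1) / 2) (- (RtoC 2 * s)))%C.

Definition is_hemisphere_zeta (N : nat) (f : C -> C) : Prop :=
  exists sigma : R, meromorphic_extension sigma (hemisphere_term N) f.

Definition Rprod (l : list R) : R := fold_right Rmult 1 l.

Definition is_central_factorial_u (u : nat -> nat -> R) : Prop :=
  u 0%nat 0%nat = 1 /\
  forall n : nat, (1 <= n)%nat ->
    u n 0%nat = 0 /\
    forall x : R,
      sum_n_m (fun k => u n k * x ^ k) 1 n
      = Rprod (map (fun i => x - INR i ^ 2) (seq 0 n)).

Definition is_central_factorial_v (v : nat -> nat -> R) : Prop :=
  forall n : nat, (1 <= n)%nat ->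
    forall x : R,
      sum_n_m (fun k => v n k * x ^ k) 1 n
      = x * Rprod (map (fun i => x - (2 * INR i - 1) ^ 2) (seq 1 (n - 1))).

Definition ubar (u : nat -> nat -> R) (n k : nat) : R :=
  2 / INR (fact (2 * n)) * u n k.

Definition vbar (v : nat -> nat -> R) (n k : nat) : R :=
  / 4 ^ (n - 1) / INR (fact (2 * n - 1)) * v n k.

Definition odd_rhs (u : nat -> nat -> R) (zeta : C -> C) (n : nat) (s : C) : C :=
  (RtoC (1 / 2) *
   @sum_n_m C_AbelianGroup (fun i : nat =>
     RtoC (ubar u (n - 1) (i - 1)) *
     (zeta (RtoC 2 * s - RtoC (2 * INR i) + RtoC 2)
      - RtoC (INR n - 1) * zeta (RtoC 2 * s - RtoC (2 * INR i) + RtoC 3))) 1 n)%C.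

Definition even_rhs (v : nat -> nat -> R) (zeta : C -> C) (n : nat) (s : C) : C :=
  @sum_n_m C_AbelianGroup (fun i : nat =>
    RtoC (vbar v n i) *
    ((cpow 2 (RtoC 2 * s - RtoC 1) - cpow 2 (RtoC (2 * INR i - 2)))
       * zeta (RtoC 2 * s - RtoC (2 * INR i) + RtoC 1)
     - RtoC (2 * INR n - 1)
       * (cpow 2 (RtoC 2 * s - RtoC 1) - cpow 2 (RtoC (2 * INR i - 3)))
       * zeta (RtoC 2 * s - RtoC (2 * INR i) + RtoC 2)))%C 1 n.

(* Main.v *)
(** For large [Re s] the binomial coefficient of the hemisphere series is a
    polynomial in the base: with [m = k + n - 1] (odd dimension [2n-1]) it is
    [(1 - (n-1)/m) * prod_{i < n-1} (m^2 - i^2) / (2n-2)!], and with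
    [l = 2k + 2n - 1] (even dimension [2n]) it is
    [(l - (2n-1)) * prod_{i=1}^{n-1} (l^2 - (2i-1)^2) / (2 * 4^(n-1) * (2n-1)!)].
    Expanding the products by the central factorial numbers gives sums of
    powers of [m], resp. of the odd number [l].  These expressions vanish for
    [1 <= m <= n-1], resp. [l = 1, 3, ..., 2n-1], so the sums may be extended to
    all [m >= 1], resp. all odd [l >= 1], and become values of zeta, resp. of
    [(1 - 2^-w) zeta(w)].  The right-hand sides are meromorphic because
    meromorphic functions are closed under sums, products and affine changes of
    variable, and any two meromorphic extensions agree by the identity
    theorem. *)

Require Import Defs.
From Stdlib Require Import Reals Lra Lia Factorial List.
From Coquelicot Require Import Coquelicot.

(** * Complex series and meromorphic functions *)

Notation Cseries := (@is_series C_AbsRing C_NormedModule).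
Notation Cpseries := (@is_pseries C_AbsRing C_NormedModule).

Lemma locally'_C (z0 : C) (P : C -> Prop) :
  locally' z0 P <->
  exists eps : R, 0 < eps /\ forall z : C, z <> z0 -> Cmod (z - z0) < eps -> P z.
Proof.
  unfold locally', within; split.
  - intros H. apply locally_C in H. destruct H as [eps H].
    exists eps; split; [apply cond_pos|]. intros z Hz Hd. now apply H.
  - intros (eps & He & H). apply locally_C.
    exists (mkposreal eps He). intros z Hd Hz. now apply H.
Qed.

Lemma sum_n_Re (a : nat -> C) (n : nat) :
  Re (@sum_n C_AbelianMonoid a n) = sum_n (fun k => Re (a k)) n.
Proof.
  induction n as [|n IH].
  - now rewrite !sum_O.
  - rewrite !sum_Sn, <- IH. reflexivity.
Qed.

Lemma sum_n_Im (a : nat -> C) (n : nat) :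
  Im (@sum_n C_AbelianMonoid a n) = sum_n (fun k => Im (a k)) n.
Proof.
  induction n as [|n IH].
  - now rewrite !sum_O.
  - rewrite !sum_Sn, <- IH. reflexivity.
Qed.

(** Balls in [C] are products of balls in the two coordinates, so the limit splits. Real series
    theorems become available for complex series. *)
Lemma is_series_C (a : nat -> C) (l : C) :
  Cseries a l <->
  is_series (fun n => Re (a n)) (Re l) /\ is_series (fun n => Im (a n)) (Im l).
Proof.
  unfold is_series; split.
  - intros H; split; apply filterlim_locally; intros eps;
      generalize (proj1 (filterlim_locally _ _) H eps);
      apply filter_imp; intros n [H1 H2].
    + now rewrite <- sum_n_Re.
    + now rewrite <- sum_n_Im.
  - intros [H1 H2]. apply filterlim_locally; intros eps.
    generalize (filter_and _ _ (proj1 (filterlim_locally _ _) H1 eps)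
                               (proj1 (filterlim_locally _ _) H2 eps)).
    apply filter_imp; intros n [K1 K2]. split.
    + rewrite <- sum_n_Re in K1. exact K1.
    + rewrite <- sum_n_Im in K2. exact K2.
Qed.

Lemma Cmod_le_Re_Im (z : C) : Cmod z <= Rabs (Re z) + Rabs (Im z).
Proof.
  replace z with (RtoC (Re z) + Ci * RtoC (Im z))%C at 1
    by (destruct z; apply injective_projections; simpl; ring).
  eapply Rle_trans; [apply Cmod_triangle|].
  rewrite Cmod_mult, Cmod_Ci, !Cmod_R; lra.
Qed.

Lemma im_le_Cmod (z : C) : Rabs (Im z) <= Cmod z.
Proof.
  eapply Rle_trans; [apply Rmax_r|apply (Rmax_Cmod z)].
Qed.

Lemma ex_series_bounded (u : nat -> R) :
  ex_series u -> exists M : R, forall n, Rabs (u n) <= M.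
Proof.
  intros Hu%ex_series_lim_0.
  destruct (filterlim_bounded u) as [M HM]; [now exists 0|]. now exists M.
Qed.

Lemma is_series_C_bounded (a : nat -> C) (l : C) :
  Cseries a l -> exists M : R, 0 < M /\ forall n, Cmod (a n) <= M.
Proof.
  intros [HR HI]%is_series_C.
  destruct (ex_series_bounded _ (ex_intro _ _ HR)) as [M1 H1].
  destruct (ex_series_bounded _ (ex_intro _ _ HI)) as [M2 H2].
  exists (M1 + M2 + 1); split.
  - pose proof (Rabs_pos (Re (a 0%nat))). pose proof (H1 0%nat).
    pose proof (Rabs_pos (Im (a 0%nat))). pose proof (H2 0%nat). lra.
  - intros n. pose proof (Cmod_le_Re_Im (a n)).
    pose proof (H1 n). pose proof (H2 n). lra.
Qed.

Lemma pow_n_Cpow (w : C) (n : nat) : @pow_n C_AbsRing w n = (w ^ n)%C.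
Proof. induction n as [|n IH]; [reflexivity|]. simpl. now rewrite <- IH. Qed.

Lemma is_pseries_C_bounded (a : nat -> C) (w l : C) :
  Cpseries a w l ->
  exists M : R, 0 < M /\ forall n, Cmod (a n) * Cmod w ^ n <= M.
Proof.
  intros [M [HM0 HM]]%is_series_C_bounded. exists M; split; [exact HM0|].
  intros n. specialize (HM n). rewrite pow_n_Cpow in HM.
  unfold scal in HM; simpl in HM. rewrite Cmod_mult, Cmod_pow in HM. lra.
Qed.

(** Abel's lemma: the terms at [w1] are bounded by some [M], so those at [w] are dominated by a
    geometric series of ratio [Cmod w / Cmod w1]. *)
Lemma pseries_C_abs_conv (a : nat -> C) (w1 w l : C) :
  Cpseries a w1 l -> Cmod w < Cmod w1 ->
  ex_series (fun n => Cmod (w ^ n * a n)%C).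
Proof.
  intros [M [HM0 HM]]%is_pseries_C_bounded Hw.
  pose proof (Cmod_ge_0 w) as Hw0.
  apply (@ex_series_le R_AbsRing R_CompleteNormedModule _
           (fun n => M * (Cmod w / Cmod w1) ^ n)).
  - intros n. unfold norm; simpl; unfold abs; simpl.
    rewrite Rabs_pos_eq by apply Cmod_ge_0.
    rewrite Cmod_mult, Cmod_pow.
    unfold Rdiv. rewrite Rpow_mult_distr, pow_inv.
    assert (0 < Cmod w1 ^ n) by (apply pow_lt; lra).
    apply Rle_trans with (Cmod w ^ n * (M * / Cmod w1 ^ n)); [|right; ring].
    apply Rmult_le_compat_l; [now apply pow_le|].
    apply (Rmult_le_reg_r (Cmod w1 ^ n)); [assumption|].
    rewrite Rmult_assoc, Rinv_l by lra. rewrite Rmult_1_r. apply HM.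
  - apply @ex_series_scal. apply ex_series_geom.
    rewrite Rabs_pos_eq.
    + apply (Rmult_lt_reg_r (Cmod w1)); [lra|]. unfold Rdiv.
      rewrite Rmult_assoc, Rinv_l by lra. lra.
    + apply Rdiv_le_0_compat; lra.
Qed.

(** Mertens' theorem for real series is applied to the four products of real and imaginary parts,
    which are absolutely convergent because each part is bounded by the modulus. *)
Lemma is_series_C_mult (a b : nat -> C) (la lb : C) :
  Cseries a la -> Cseries b lb ->
  ex_series (fun n => Cmod (a n)) -> ex_series (fun n => Cmod (b n)) ->
  Cseries (fun n => @sum_n C_AbelianMonoid (fun k => (a k * b (n - k)%nat)%C) n) (la * lb)%C.
Proof.
  assert (abs_part : forall (p : C -> R) (u : nat -> C),
    (forall z, Rabs (p z) <= Cmod z) ->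
    ex_series (fun n => Cmod (u n)) -> ex_series (fun n => Rabs (p (u n)))).
  { intros p u Hp Hu.
    apply (@ex_series_le R_AbsRing R_CompleteNormedModule _ (fun n => Cmod (u n))); [|exact Hu].
    intros n. unfold norm; simpl; unfold abs; simpl. rewrite Rabs_Rabsolu. apply Hp. }
  intros [HaR HaI]%is_series_C [HbR HbI]%is_series_C Ha Hb.
  pose proof (abs_part Re a re_le_Cmod Ha) as AR.
  pose proof (abs_part Im a im_le_Cmod Ha) as AI.
  pose proof (abs_part Re b re_le_Cmod Hb) as BR.
  pose proof (abs_part Im b im_le_Cmod Hb) as BI.
  apply is_series_C; split.
  - apply is_series_ext with (2 := is_series_minus _ _ _ _
      (is_series_mult _ _ _ _ HaR HbR AR BR) (is_series_mult _ _ _ _ HaI HbI AI BI)).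
    intros n. rewrite sum_n_Re, sum_n_Reals. unfold plus, opp; simpl.
    rewrite <- Rminus_def, <- minus_sum. apply sum_eq. intros; reflexivity.
  - apply is_series_ext with (2 := is_series_plus _ _ _ _
      (is_series_mult _ _ _ _ HaR HbI AR BI) (is_series_mult _ _ _ _ HaI HbR AI BR)).
    intros n. rewrite sum_n_Im, sum_n_Reals. unfold plus; simpl.
    rewrite <- sum_plus. apply sum_eq. intros; reflexivity.
Qed.

Lemma is_pseries_C_mult (a b : nat -> C) (w la lb : C) :
  Cpseries a w la -> Cpseries b w lb ->
  ex_series (fun n => Cmod (w ^ n * a n)%C) -> ex_series (fun n => Cmod (w ^ n * b n)%C) ->
  Cpseries (fun n => @sum_n C_AbelianMonoid (fun k => (a k * b (n - k)%nat)%C) n) w (la * lb)%C.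
Proof.
  intros Ha Hb Aa Ab. unfold is_pseries in *.
  apply is_series_ext with (a := fun n => @sum_n C_AbelianMonoid
     (fun k => ((w ^ k * a k) * (w ^ (n - k) * b (n - k)%nat))%C) n).
  - intros n. rewrite pow_n_Cpow. unfold scal; simpl.
    etransitivity; [|apply (@sum_n_mult_l C_Ring)].
    apply sum_n_ext_loc. intros k Hk. unfold mult; simpl.
    replace (w ^ n)%C with (w ^ k * w ^ (n - k))%C; [ring|].
    rewrite <- Cpow_add_r. f_equal. lia.
  - apply (is_series_C_mult (fun k => (w ^ k * a k)%C) (fun k => (w ^ k * b k)%C)); assumption.
Qed.

Lemma is_pseries_C_scal_arg (a : nat -> C) (c w l : C) :
  Cpseries a (c * w)%C l -> Cpseries (fun n => (c ^ n * a n)%C) w l.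
Proof.
  apply is_series_ext. intros n. unfold scal; simpl. unfold mult; simpl.
  rewrite (pow_n_Cpow (c * w) n), (pow_n_Cpow w n), Cpow_mult_l. ring.
Qed.

Lemma is_pseries_C_shift (a : nat -> C) (m : nat) (w l : C) :
  Cpseries a w l -> Cpseries (@PS_incr_n C_AbsRing C_NormedModule a m) w (w ^ m * l)%C.
Proof.
  intros H. apply (is_pseries_incr_n a m) in H. now rewrite pow_n_Cpow in H.
Qed.

(** * Closure properties of meromorphic functions *)

Lemma meromorphicP (f : C -> C) :
  meromorphic f <->
  forall z0 : C, exists (m : nat) (a : nat -> C) (eps : R), 0 < eps /\
    forall w : C, w <> 0 -> Cmod w < eps -> Cpseries a w (w ^ m * f (z0 + w))%C.
Proof.
  split; intros H z0; destruct (H z0) as (m & a & Ha).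
  - apply locally'_C in Ha. destruct Ha as (eps & He & Ha).
    exists m, a, eps; split; [exact He|]. intros w Hw Hd.
    specialize (Ha (z0 + w)%C). replace (z0 + w - z0)%C with w in Ha by ring.
    rewrite pow_n_Cpow in Ha. apply Ha; [|exact Hd].
    intros E. apply Hw. replace w with (z0 + w - z0)%C by ring. rewrite E. ring.
  - destruct Ha as (eps & He & Ha).
    exists m, a. apply locally'_C. exists eps; split; [exact He|]. intros z Hz Hd.
    specialize (Ha (z - z0)%C). rewrite pow_n_Cpow.
    replace (z0 + (z - z0))%C with z in Ha by ring. apply Ha; [|exact Hd].
    intros E. apply Hz. replace z with (z0 + (z - z0))%C by ring. rewrite E. ring.
Qed.

Lemma meromorphic_ext (f g : C -> C) :
  (forall z, f z = g z) -> meromorphic f -> meromorphic g.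
Proof.
  rewrite !meromorphicP. intros E H z0.
  destruct (H z0) as (m & a & eps & He & Ha). exists m, a, eps; split; [exact He|].
  intros w. rewrite <- E. apply Ha.
Qed.

Lemma meromorphic_plus (f g : C -> C) :
  meromorphic f -> meromorphic g -> meromorphic (fun z => (f z + g z)%C).
Proof.
  rewrite !meromorphicP. intros Hf Hg z0.
  destruct (Hf z0) as (m & a & e1 & He1 & Ha).
  destruct (Hg z0) as (p & b & e2 & He2 & Hb).
  (* Both functions are brought to the common pole order [m + p]: the series of [f] is shifted by
     [p], that of [g] by [m]. *)
  exists (m + p)%nat, (@PS_plus C_AbsRing C_NormedModule
     (@PS_incr_n C_AbsRing C_NormedModule a p) (@PS_incr_n C_AbsRing C_NormedModule b m)),
     (Rmin e1 e2).
  split; [now apply Rmin_glb_lt|]. intros w Hw Hd.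
  pose proof (Rmin_l e1 e2). pose proof (Rmin_r e1 e2).
  replace (w ^ (m + p) * (f (z0 + w) + g (z0 + w)))%C
    with (w ^ p * (w ^ m * f (z0 + w)) + w ^ m * (w ^ p * g (z0 + w)))%C
    by (rewrite Cpow_add_r; ring).
  apply (@is_pseries_plus C_AbsRing C_NormedModule);
    apply is_pseries_C_shift; [apply Ha|apply Hb]; trivial; lra.
Qed.

Lemma meromorphic_mult (f g : C -> C) :
  meromorphic f -> meromorphic g -> meromorphic (fun z => (f z * g z)%C).
Proof.
  rewrite !meromorphicP. intros Hf Hg z0.
  destruct (Hf z0) as (m & a & e1 & He1 & Ha).
  destruct (Hg z0) as (p & b & e2 & He2 & Hb).
  (* Halving the radius puts the real point [e] inside both discs and strictly farther out than
     every [w] considered. Convergence at [e] then gives the absolute convergence that the Cauchy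
     product needs. *)
  set (e := Rmin e1 e2 / 2).
  assert (He : 0 < e /\ e < e1 /\ e < e2).
  { pose proof (Rmin_l e1 e2). pose proof (Rmin_r e1 e2).
    pose proof (Rmin_glb_lt e1 e2 0 He1 He2). unfold e. lra. }
  exists (m + p)%nat, (fun n => @sum_n C_AbelianMonoid (fun k => (a k * b (n - k)%nat)%C) n), e.
  split; [lra|]. intros w Hw Hd.
  assert (Hm : Cmod (RtoC e) = e) by (rewrite Cmod_R; apply Rabs_pos_eq; lra).
  assert (Hn : RtoC e <> 0) by (intros E; apply RtoC_inj in E; lra).
  replace (w ^ (m + p) * (f (z0 + w) * g (z0 + w)))%C
    with ((w ^ m * f (z0 + w)) * (w ^ p * g (z0 + w)))%C by (rewrite Cpow_add_r; ring).
  apply is_pseries_C_mult.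
  - apply Ha; trivial; lra.
  - apply Hb; trivial; lra.
  - eapply pseries_C_abs_conv; [apply (Ha (RtoC e)); trivial; lra|lra].
  - eapply pseries_C_abs_conv; [apply (Hb (RtoC e)); trivial; lra|lra].
Qed.

Lemma meromorphic_affine (f : C -> C) (c d : C) :
  c <> 0 -> meromorphic f -> meromorphic (fun z => f (c * z + d)%C).
Proof.
  rewrite !meromorphicP. intros Hc H z0.
  destruct (H (c * z0 + d)%C) as (m & a & eps & He & Ha).
  assert (Hc0 : 0 < Cmod c) by now apply Cmod_gt_0.
  (* The displacement [w] becomes [c * w]: the factor [c ^ n] rescales the coefficients and
     [/ c ^ m] turns [(c * w) ^ m] back into [w ^ m]. *)
  exists m, (fun n => (/ c ^ m * (c ^ n * a n))%C), (eps / Cmod c); split.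
  { now apply Rdiv_lt_0_compat. }
  intros w Hw Hd.
  replace (w ^ m * f (c * (z0 + w) + d))%C
    with (/ c ^ m * ((c * w) ^ m * f (c * z0 + d + c * w)))%C.
  - apply (@is_pseries_scal C_AbsRing C_NormedModule); [apply Cmult_comm|].
    apply is_pseries_C_scal_arg. apply Ha; [now apply Cmult_neq_0|].
    rewrite Cmod_mult. apply (Rmult_lt_compat_l (Cmod c)) in Hd; [|exact Hc0].
    replace (Cmod c * (eps / Cmod c)) with eps in Hd by (field; lra). exact Hd.
  - rewrite Cpow_mult_l.
    replace (c * (z0 + w) + d)%C with (c * z0 + d + c * w)%C by ring.
    field. now apply Cpow_nz.
Qed.

Lemma meromorphic_of_entire (f : C -> C) :
  (forall z0, exists a, forall w, Cpseries a w (f (z0 + w)%C)) -> meromorphic f.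
Proof.
  intros H. apply meromorphicP. intros z0. destruct (H z0) as [a Ha].
  exists 0%nat, a, 1; split; [lra|]. intros w _ _. simpl. rewrite Cmult_1_l. apply Ha.
Qed.

Lemma meromorphic_const (c : C) : meromorphic (fun _ => c).
Proof.
  apply meromorphic_of_entire. intros z0.
  exists (fun n => match n with O => c | _ => RtoC 0 end). intros w.
  apply (@is_series_decr_1 C_AbsRing C_NormedModule).
  apply is_series_ext with (a := fun _ => zero : C).
  { intros n. unfold scal, zero; simpl. unfold mult; simpl. ring. }
  replace (plus _ _) with (zero : C).
  - unfold is_series. apply filterlim_ext with (f := fun _ => zero : C).
    + intros n. symmetry. apply (@sum_n_m_const_zero C_AbelianMonoid).
    + apply filterlim_const.
  - unfold scal; simpl. unfold mult, plus, opp; simpl. unfold one, zero; simpl. ring.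
Qed.

Lemma meromorphic_minus (f g : C -> C) :
  meromorphic f -> meromorphic g -> meromorphic (fun z => (f z - g z)%C).
Proof.
  intros Hf Hg. apply (meromorphic_ext (fun z => (f z + RtoC (-1) * g z)%C)).
  - intros z. ring.
  - apply meromorphic_plus; [exact Hf|].
    apply meromorphic_mult; [apply meromorphic_const|exact Hg].
Qed.

(** * The complex exponential *)

(** For every real [r] the terms [a n * r ^ n] are dominated by those of the series of
    [exp (K * Rabs r)], hence bounded, so no real number exceeds the radius. *)
Lemma CV_radius_exp_bound (a : nat -> R) (K : R) :
  (forall n, Rabs (a n) <= K ^ n / INR (fact n)) -> CV_radius a = p_infty.
Proof.
  intros Ha.
  assert (H : forall r : R, Rbar_le r (CV_radius a)).
  { intros r. apply (CV_radius_bounded a).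
    destruct (ex_series_bounded (fun n => (K * Rabs r) ^ n / INR (fact n))) as [M HM].
    { exists (exp (K * Rabs r)).
      eapply is_series_ext; [|exact (proj1 (is_pseries_R _ _ _) (is_exp_Reals (K * Rabs r)))].
      intros n. simpl. unfold Rdiv. ring. }
    exists M. intros n. eapply Rle_trans; [|eapply Rle_trans; [apply Rle_abs|apply (HM n)]].
    rewrite Rabs_mult, Rpow_mult_distr, <- RPow_abs.
    apply Rle_trans with (K ^ n / INR (fact n) * Rabs r ^ n); [|right; unfold Rdiv; ring].
    apply Rmult_le_compat_r; [apply pow_le, Rabs_pos|apply Ha]. }
  destruct (CV_radius a) as [r| |]; trivial.
  - exfalso. specialize (H (r + 1)). simpl in H. lra.
  - exfalso. exact (H 0).
Qed.

Definition Cexp (w : C) : C := (exp (Re w) * cos (Im w), exp (Re w) * sin (Im w)).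

(* With [P + i Q] the sum of the series at [t w], the product
   [exp (- t w) (P + i Q)] has zero derivative in the real variable [t]. *)
Lemma Cexp_series (w : C) : Cpseries (fun n => RtoC (/ INR (fact n))) w (Cexp w).
Proof.
  set (x := Re w). set (y := Im w).
  set (A := fun n => Re (w ^ n)%C / INR (fact n)).
  set (B := fun n => Im (w ^ n)%C / INR (fact n)).
  assert (bound : forall p : C -> R, (forall z, Rabs (p z) <= Cmod z) ->
            forall n, Rabs (p (w ^ n)%C / INR (fact n)) <= Cmod w ^ n / INR (fact n)).
  { intros p Hp n. pose proof (INR_fact_lt_0 n) as Hf.
    unfold Rdiv. rewrite Rabs_mult, (Rabs_pos_eq (/ _)) by (left; now apply Rinv_0_lt_compat).
    apply Rmult_le_compat_r; [left; now apply Rinv_0_lt_compat|].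
    rewrite <- Cmod_pow. apply Hp. }
  assert (RA : forall t : R, Rbar_lt (Rabs t) (CV_radius A)).
  { intros t. unfold A. rewrite (CV_radius_exp_bound _ (Cmod w)); [exact I|].
    exact (bound Re re_le_Cmod). }
  assert (RB : forall t : R, Rbar_lt (Rabs t) (CV_radius B)).
  { intros t. unfold B. rewrite (CV_radius_exp_bound _ (Cmod w)); [exact I|].
    exact (bound Im im_le_Cmod). }
  set (P := PSeries A). set (Q := PSeries B).
  assert (EA : forall t : R, ex_pseries A t) by (intros; now apply CV_radius_inside).
  assert (EB : forall t : R, ex_pseries B t) by (intros; now apply CV_radius_inside).
  assert (fact_S : forall n r, INR (S n) * (r / INR (fact (S n))) = r / INR (fact n)).
  { intros n r. change (fact (S n)) with (S n * fact n)%nat. rewrite mult_INR.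
    field. split; [apply INR_fact_neq_0|apply not_0_INR; lia]. }
  (* Termwise differentiation and [w ^ (n+1) = w * w ^ n] give [(P + i Q)' = w (P + i Q)]; [DP] and
     [DQ] are its real and imaginary parts. *)
  assert (DP : forall t : R, is_derive P t (x * P t - y * Q t)).
  { intros t. evar_last; [now apply is_derive_PSeries|].
    apply is_pseries_unique.
    eapply is_pseries_ext;
      [|apply (is_pseries_minus (PS_scal x A) (PS_scal y B) t (x * P t) (y * Q t))].
    - intros n. unfold PS_derive, A. rewrite fact_S.
      unfold PS_minus, PS_plus, PS_opp, PS_scal, B, A, plus, opp, scal; simpl.
      unfold mult; simpl. unfold x, y, Re, Im, Rdiv. ring.
    - apply (is_pseries_scal x A); [apply Rmult_comm|]. now apply PSeries_correct.
    - apply (is_pseries_scal y B); [apply Rmult_comm|]. now apply PSeries_correct. }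
  assert (DQ : forall t : R, is_derive Q t (x * Q t + y * P t)).
  { intros t. evar_last; [now apply is_derive_PSeries|].
    apply is_pseries_unique.
    eapply is_pseries_ext;
      [|apply (is_pseries_plus (PS_scal x B) (PS_scal y A) t (x * Q t) (y * P t))].
    - intros n. unfold PS_derive, B. rewrite fact_S.
      unfold PS_plus, PS_scal, B, A, plus, scal; simpl.
      unfold mult; simpl. unfold x, y, Re, Im, Rdiv. ring.
    - apply (is_pseries_scal x B); [apply Rmult_comm|]. now apply PSeries_correct.
    - apply (is_pseries_scal y A); [apply Rmult_comm|]. now apply PSeries_correct. }
  assert (P0 : P 0 = 1) by (unfold P; rewrite PSeries_0; unfold A; simpl; field).
  assert (Q0 : Q 0 = 0) by (unfold Q; rewrite PSeries_0; unfold B; simpl; field).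
  (* [F] and [G] compare the real and imaginary parts of [exp (- t w) (P + i Q)] at [t = 0] and
     [t = 1]. The values at 0 are 1 and 0, and a rotation by [y] then solves for [P 1] and [Q 1]. *)
  assert (F : exp (- (0 * x)) * (cos (0 * y) * P 0 + sin (0 * y) * Q 0)
              = exp (- (1 * x)) * (cos (1 * y) * P 1 + sin (1 * y) * Q 1)).
  { apply (eq_is_derive
      (fun t => exp (- (t * x)) * (cos (t * y) * P t + sin (t * y) * Q t))); [|lra].
    intros t _. auto_derive.
    - repeat split; eexists; [apply DP|apply DQ].
    - rewrite (is_derive_unique (fun u : R => P u) _ _ (DP t)),
        (is_derive_unique (fun u : R => Q u) _ _ (DQ t)).
      unfold zero; simpl. ring. }
  assert (G : exp (- (0 * x)) * (cos (0 * y) * Q 0 - sin (0 * y) * P 0)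
              = exp (- (1 * x)) * (cos (1 * y) * Q 1 - sin (1 * y) * P 1)).
  { apply (eq_is_derive
      (fun t => exp (- (t * x)) * (cos (t * y) * Q t - sin (t * y) * P t))); [|lra].
    intros t _. auto_derive.
    - repeat split; eexists; [apply DQ|apply DP].
    - rewrite (is_derive_unique (fun u : R => P u) _ _ (DP t)),
        (is_derive_unique (fun u : R => Q u) _ _ (DQ t)).
      unfold zero; simpl. ring. }
  rewrite !Rmult_0_l, !Rmult_1_l, Ropp_0, exp_0, cos_0, sin_0, P0, Q0 in F, G.
  rewrite exp_Ropp in F, G.
  pose proof (exp_pos x) as Hx. pose proof (sin2_cos2 y) as Hsc. unfold Rsqr in Hsc.
  assert (F' : exp x = cos y * P 1 + sin y * Q 1).
  { apply (Rmult_eq_compat_l (exp x)) in F. field_simplify in F; lra. }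
  assert (G' : 0 = cos y * Q 1 - sin y * P 1).
  { apply (Rmult_eq_compat_l (exp x)) in G. field_simplify in G; lra. }
  assert (E : cos y * Q 1 = sin y * P 1) by lra.
  assert (HP : P 1 = exp x * cos y).
  { transitivity (cos y * cos y * P 1 + sin y * (cos y * Q 1)); [|rewrite F'; ring].
    rewrite E. transitivity ((sin y * sin y + cos y * cos y) * P 1); [|ring].
    rewrite Hsc; ring. }
  assert (HQ : Q 1 = exp x * sin y).
  { transitivity (sin y * sin y * Q 1 + cos y * (sin y * P 1)); [|rewrite F'; ring].
    rewrite <- E. transitivity ((sin y * sin y + cos y * cos y) * Q 1); [|ring].
    rewrite Hsc; ring. }
  apply is_series_C. unfold Cexp. simpl Re at 2. simpl Im at 3.
  fold x y. rewrite <- HP, <- HQ. split.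
  - eapply is_series_ext; [|exact (proj1 (is_pseries_R _ _ _) (PSeries_correct A 1 (EA 1)))].
    intros n. rewrite pow_n_Cpow. unfold scal; simpl. unfold A. rewrite pow1. unfold Re, Rdiv. ring.
  - eapply is_series_ext; [|exact (proj1 (is_pseries_R _ _ _) (PSeries_correct B 1 (EB 1)))].
    intros n. rewrite pow_n_Cpow. unfold scal; simpl. unfold B. rewrite pow1. unfold Im, Rdiv. ring.
Qed.

Lemma cpow_plus (x : R) (s w : C) : cpow x (s + w)%C = (cpow x s * cpow x w)%C.
Proof.
  unfold cpow. destruct s as [a b], w as [c d]. simpl.
  rewrite Rpower_plus, Rmult_plus_distr_r, cos_plus, sin_plus.
  apply injective_projections; simpl; ring.
Qed.

Lemma cpow_Cexp (x : R) (w : C) : cpow x w = Cexp (RtoC (ln x) * w)%C.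
Proof.
  unfold cpow, Cexp, Rpower. destruct w as [a b]. simpl.
  replace (ln x * a - 0 * b) with (a * ln x) by ring.
  now replace (ln x * b + 0 * a) with (b * ln x) by ring.
Qed.

Lemma meromorphic_cpow (x : R) : meromorphic (cpow x).
Proof.
  apply meromorphic_of_entire. intros z0.
  exists (fun n => (cpow x z0 * (RtoC (ln x) ^ n * RtoC (/ INR (fact n))))%C). intros w.
  rewrite cpow_plus, (cpow_Cexp x w).
  apply (@is_pseries_scal C_AbsRing C_NormedModule); [apply Cmult_comm|].
  apply is_pseries_C_scal_arg, Cexp_series.
Qed.

(** * The identity theorem *)

(** When the sum is 0, the first possibly nonzero term [b n] is cancelled by the tail after it,
    which is at most [K (1 + 1/2 + 1/4 + ...) = 2 K]. *)
Lemma Cseries_tail_small (b : nat -> C) (n : nat) (K : R) :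
  Cseries b (RtoC 0) -> (forall k, (k < n)%nat -> b k = RtoC 0) ->
  (forall j, Cmod (b (n + S j)%nat) <= K * (/ 2) ^ j) ->
  Cmod (b n) <= 2 * K.
Proof.
  intros Hb Hz HK.
  assert (S0 : @sum_n C_AbelianMonoid b n = b n).
  { destruct n as [|n]; [apply sum_O|].
    rewrite sum_Sn. rewrite (sum_n_ext_loc b (fun _ => zero)) by (intros; apply Hz; lia).
    unfold sum_n. rewrite sum_n_m_const_zero. apply plus_zero_l. }
  assert (partial : forall j,
    Cmod (@sum_n C_AbelianMonoid b (n + j) - b n)%C <= 2 * K * (1 - (/ 2) ^ j)).
  { induction j as [|j IH].
    - rewrite Nat.add_0_r, S0. replace (b n - b n)%C with (RtoC 0) by ring.
      rewrite Cmod_0. simpl. lra.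
    - rewrite Nat.add_succ_r, sum_Sn.
      change (plus (sum_n b (n + j)) (b (S (n + j))))
        with (@sum_n C_AbelianMonoid b (n + j) + b (S (n + j)))%C.
      replace (@sum_n C_AbelianMonoid b (n + j) + b (S (n + j)) - b n)%C
        with ((@sum_n C_AbelianMonoid b (n + j) - b n) + b (S (n + j)))%C by ring.
      eapply Rle_trans; [apply Cmod_triangle|].
      specialize (HK j). rewrite Nat.add_succ_r in HK. simpl pow. lra. }
  assert (K0 : 0 <= K).
  { specialize (HK 0%nat). simpl in HK. pose proof (Cmod_ge_0 (b (n + 1)%nat)). lra. }
  apply Rnot_lt_le. intros Hlt.
  (* A partial sum within this gap of 0 would force its tail part to exceed [2 * K], against
     [partial]. *)
  set (eps := Cmod (b n) - 2 * K). assert (He : 0 < eps) by (unfold eps; lra).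
  destruct (proj1 (filterlim_locally_ball_norm _ _) Hb (mkposreal eps He)) as [N HN].
  specialize (HN (n + N)%nat ltac:(lia)). specialize (partial N).
  assert (HN' : Cmod (@sum_n C_AbelianMonoid b (n + N) - RtoC 0)%C < eps) by exact HN.
  assert (Cmod (b n) <= Cmod (@sum_n C_AbelianMonoid b (n + N) - b n)%C
                        + Cmod (@sum_n C_AbelianMonoid b (n + N) - RtoC 0)%C).
  { rewrite <- (Cmod_opp (_ - b n)%C).
    eapply Rle_trans; [|apply Cmod_triangle]. right. f_equal. ring. }
  assert (0 < (/ 2) ^ N) by (apply pow_lt; lra).
  assert (0 <= K * (/ 2) ^ N) by (apply Rmult_le_pos; lra).
  unfold eps in *. lra.
Qed.

(** Strong induction on [n]: once the lower coefficients vanish, the leading term [a n * w ^ n] at a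
    zero [w] must be cancelled by terms of order [n + 1] and higher, which is impossible for small
    [w] unless [a n = 0]. *)
Lemma pseries_C_cluster_zeros (a : nat -> C) (w1 l1 : C) :
  w1 <> RtoC 0 -> Cpseries a w1 l1 ->
  (forall eps : R, 0 < eps ->
     exists w : C, w <> RtoC 0 /\ Cmod w < eps /\ Cpseries a w (RtoC 0)) ->
  forall n, a n = RtoC 0.
Proof.
  intros Hw1 H1 Hacc.
  apply is_pseries_C_bounded in H1. destruct H1 as [M [HM0 HM]].
  assert (Hr : 0 < Cmod w1) by now apply Cmod_gt_0.
  set (r := Cmod w1) in *.
  induction n as [n IH] using (well_founded_induction Wf_nat.lt_wf).
  apply Cmod_eq_0. apply Rle_antisym; [|apply Cmod_ge_0].
  apply Rnot_lt_le. intros Ha.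
  assert (Hrn : 0 < r ^ S n) by now apply pow_lt.
  (* The bound [r / 2] makes the tail geometric with ratio at most 1/2; the second bound contradicts
     the estimate [T'] obtained below. *)
  destruct (Hacc (Rmin (r / 2) (Cmod (a n) * r ^ S n / (2 * M)))) as (w & Hw0 & Hw & Hs).
  { apply Rmin_glb_lt; [lra|]. apply Rdiv_lt_0_compat; [|lra]. now apply Rmult_lt_0_compat. }
  assert (Hwr := Rlt_le_trans _ _ _ Hw (Rmin_l _ _)).
  assert (Hwa := Rlt_le_trans _ _ _ Hw (Rmin_r _ _)).
  assert (Hwp : 0 < Cmod w) by now apply Cmod_gt_0.
  assert (Hq : 0 <= Cmod w / r <= / 2).
  { split; [apply Rdiv_le_0_compat; lra|].
    apply (Rmult_le_reg_r r); [exact Hr|]. unfold Rdiv. rewrite Rmult_assoc, Rinv_l; lra. }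
  assert (T : Cmod (w ^ n * a n)%C <= 2 * (M * (Cmod w / r) ^ S n)).
  { apply (Cseries_tail_small (fun k => (w ^ k * a k)%C)).
    - exact Hs.
    - intros k Hk. rewrite (IH k Hk). ring.
    - intros j. rewrite Cmod_mult, Cmod_pow.
      apply Rle_trans with (M * (Cmod w / r) ^ (n + S j)).
      + unfold Rdiv. rewrite Rpow_mult_distr, pow_inv.
        assert (0 < r ^ (n + S j)) by now apply pow_lt.
        apply Rle_trans with (Cmod w ^ (n + S j) * (M * / r ^ (n + S j))); [|right; ring].
        apply Rmult_le_compat_l; [apply pow_le; lra|].
        apply (Rmult_le_reg_r (r ^ (n + S j))); [assumption|].
        rewrite Rmult_assoc, Rinv_l, Rmult_1_r by lra. apply HM.
      + replace (n + S j)%nat with (S n + j)%nat by lia. rewrite pow_add, <- Rmult_assoc.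
        apply Rmult_le_compat_l.
        * apply Rmult_le_pos; [lra|]. apply pow_le; lra.
        * apply pow_incr; lra. }
  rewrite Cmod_mult, Cmod_pow in T. unfold Rdiv in T.
  rewrite Rpow_mult_distr, pow_inv in T.
  assert (Hwn : 0 < Cmod w ^ n) by now apply pow_lt.
  assert (T' : Cmod (a n) * r ^ S n <= 2 * M * Cmod w).
  { apply (Rmult_le_reg_l (Cmod w ^ n)); [exact Hwn|].
    apply (Rmult_le_compat_r (r ^ S n)) in T; [|lra].
    replace (2 * (M * (Cmod w ^ S n * / r ^ S n)) * r ^ S n)
      with (Cmod w ^ n * (2 * M * Cmod w)) in T
      by (rewrite <- (tech_pow_Rmult (Cmod w)); field; lra).
    lra. }
  apply (Rmult_lt_compat_r (2 * M)) in Hwa; [|lra].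
  unfold Rdiv in Hwa. rewrite (Rmult_assoc _ (/ _)), Rinv_l in Hwa by lra. lra.
Qed.

(** Zeros of [f] accumulating at [p] are zeros of the power series of [(z - p) ^ m * f z], so all
    its coefficients vanish. Away from [p] the factor [(z - p) ^ m] is nonzero and can be
    cancelled. *)
Lemma meromorphic_cluster_zeros (f : C -> C) (p : C) :
  meromorphic f ->
  (forall eps : R, 0 < eps -> exists z : C, z <> p /\ Cmod (z - p) < eps /\ f z = RtoC 0) ->
  locally' p (fun z => f z = RtoC 0).
Proof.
  rewrite meromorphicP. intros Hf Hacc.
  destruct (Hf p) as (m & a & e & He & Ha).
  assert (Hm : Cmod (RtoC (e / 2)) = e / 2) by (rewrite Cmod_R; apply Rabs_pos_eq; lra).
  assert (Hn : RtoC (e / 2) <> 0) by (intros E; apply RtoC_inj in E; lra).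
  assert (a0 : forall n, a n = RtoC 0).
  { apply (pseries_C_cluster_zeros a (RtoC (e / 2)) _ Hn (Ha _ Hn ltac:(lra))).
    intros eps Heps. destruct (Hacc (Rmin e eps)) as (z & Hzp & Hz & Hfz).
    { now apply Rmin_glb_lt. }
    pose proof (Rmin_l e eps). pose proof (Rmin_r e eps).
    assert (Hzp' : (z - p)%C <> 0) by now apply Cminus_eq_contra.
    exists (z - p)%C. split; [exact Hzp'|]. split; [lra|].
    specialize (Ha (z - p)%C Hzp' ltac:(lra)).
    replace (p + (z - p))%C with z in Ha by ring.
    rewrite Hfz, Cmult_0_r in Ha. exact Ha. }
  apply locally'_C. exists e; split; [exact He|]. intros z Hzp Hz.
  assert (Hzp' : (z - p)%C <> 0) by now apply Cminus_eq_contra.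
  specialize (Ha (z - p)%C Hzp' Hz).
  replace (p + (z - p))%C with z in Ha by ring.
  destruct (Ceq_dec (f z) 0) as [E|E]; [exact E|exfalso].
  apply (Cmult_neq_0 _ _ (Cpow_nz _ m Hzp') E).
  apply (filterlim_locally_unique _ _ _ Ha).
  apply filterlim_ext with (f := fun _ => zero : C); [|apply filterlim_const].
  intros n. symmetry. etransitivity; [|apply (@sum_n_m_const_zero C_AbelianMonoid 0 n)].
  apply sum_n_m_ext. intros k. rewrite a0. apply (@scal_zero_r C_Ring C_ModuleSpace).
Qed.

(** Punctured neighbourhoods of two centres are compared below, so a point must avoid both. Of
    [p + eps / 2] and [p + eps / 3] at most one equals [q]. *)
Lemma exists_near_avoiding (p q : C) (eps : R) :
  0 < eps -> exists z : C, z <> p /\ z <> q /\ Cmod (z - p) < eps.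
Proof.
  intros He.
  assert (main : forall t : R, 0 < t < eps ->
    (p + RtoC t)%C <> p /\ Cmod (p + RtoC t - p) < eps).
  { intros t Ht. replace (p + RtoC t - p)%C with (RtoC t) by ring.
    rewrite Cmod_R, Rabs_pos_eq by lra. split; [|lra].
    intros E. assert (E' : RtoC t = 0).
    { replace (RtoC t) with (p + RtoC t - p)%C by ring. rewrite E. ring. }
    apply RtoC_inj in E'. lra. }
  destruct (Ceq_dec (p + RtoC (eps / 2)) q) as [E|E].
  - exists (p + RtoC (eps / 3))%C. destruct (main (eps / 3)) as [H1 H2]; [lra|].
    split; [exact H1|]. split; [|exact H2]. intros E'. rewrite <- E in E'.
    assert (E2 : RtoC (eps / 3) = RtoC (eps / 2)).
    { replace (RtoC (eps / 3)) with (p + RtoC (eps / 3) - p)%C by ring. rewrite E'. ring. }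
    apply RtoC_inj in E2. lra.
  - exists (p + RtoC (eps / 2))%C. destruct (main (eps / 2)) as [H1 H2]; [lra|]. auto.
Qed.

(** The openness half of continuation: zeros fill the punctured disc about [p], so they accumulate
    at each of its points [q]. *)
Lemma meromorphic_zero_nearby (f : C -> C) (p q : C) (e : R) :
  meromorphic f ->
  (forall z : C, z <> p -> Cmod (z - p) < e -> f z = RtoC 0) -> Cmod (q - p) < e ->
  locally' q (fun z => f z = RtoC 0).
Proof.
  intros Hf Hp Hq. apply meromorphic_cluster_zeros; [exact Hf|]. intros eps Heps.
  destruct (exists_near_avoiding q p (Rmin eps (e - Cmod (q - p)))) as (z & Hzq & Hzp & Hz).
  { apply Rmin_glb_lt; lra. }
  pose proof (Rmin_l eps (e - Cmod (q - p))). pose proof (Rmin_r eps (e - Cmod (q - p))).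
  exists z. split; [exact Hzq|]. split; [lra|]. apply Hp; [exact Hzp|].
  replace (z - p)%C with ((z - q) + (q - p))%C by ring.
  eapply Rle_lt_trans; [apply Cmod_triangle|]. lra.
Qed.

(** The closedness half of continuation: zeros near the points [q] accumulate at their limit [p]. *)
Lemma meromorphic_zero_limit (f : C -> C) (p : C) :
  meromorphic f ->
  (forall eps : R, 0 < eps ->
     exists q : C, Cmod (q - p) < eps /\ locally' q (fun z => f z = RtoC 0)) ->
  locally' p (fun z => f z = RtoC 0).
Proof.
  intros Hf H. apply meromorphic_cluster_zeros; [exact Hf|]. intros eps Heps.
  destruct (H eps Heps) as (q & Hqp & Hq). apply locally'_C in Hq.
  destruct Hq as (e & He & Hq).
  destruct (exists_near_avoiding q p (Rmin e (eps - Cmod (q - p)))) as (z & Hzq & Hzp & Hz).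
  { apply Rmin_glb_lt; lra. }
  pose proof (Rmin_l e (eps - Cmod (q - p))). pose proof (Rmin_r e (eps - Cmod (q - p))).
  exists z. split; [exact Hzp|]. split; [|apply Hq; [exact Hzq|lra]].
  replace (z - p)%C with ((z - q) + (q - p))%C by ring.
  eapply Rle_lt_trans; [apply Cmod_triangle|]. lra.
Qed.

(* Continuation along the segment from [p] to [q]: the supremum [T] of the
   parameters up to which [f] vanishes near the segment is attained, by
   [meromorphic_zero_limit], and is [1], by [meromorphic_zero_nearby]. *)
Lemma meromorphic_identity (f : C -> C) (p q : C) :
  meromorphic f -> locally' p (fun z => f z = RtoC 0) -> locally' q (fun z => f z = RtoC 0).
Proof.
  intros Hf Hp.
  set (g := fun t : R => (p + RtoC t * (q - p))%C).
  (* A Lipschitz constant for [g]; the added 1 keeps it positive when [p = q]. *)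
  set (L := Cmod (q - p) + 1).
  assert (HL : 0 < L) by (pose proof (Cmod_ge_0 (q - p)); unfold L; lra).
  assert (Hg : forall s t, Cmod (g s - g t) <= Rabs (s - t) * L).
  { intros s t. unfold g.
    replace (_ - _)%C with (RtoC (s - t) * (q - p))%C by (rewrite RtoC_minus; ring).
    rewrite Cmod_mult, Cmod_R. apply Rmult_le_compat_l; [apply Rabs_pos|unfold L; lra]. }
  set (E := fun t => 0 <= t <= 1 /\
              forall s, 0 <= s <= t -> locally' (g s) (fun z => f z = RtoC 0)).
  assert (E0 : E 0).
  { split; [lra|]. intros s Hs. replace s with 0 by lra.
    unfold g. now replace (p + RtoC 0 * (q - p))%C with p by ring. }
  destruct (completeness E) as [T [HT1 HT2]].
  { exists 1. intros t [Ht _]. lra. }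
  { now exists 0. }
  assert (T0 : 0 <= T <= 1).
  { split; [now apply HT1|]. apply HT2. intros t [Ht _]. lra. }
  assert (Hbelow : forall s, 0 <= s < T -> locally' (g s) (fun z => f z = RtoC 0)).
  { intros s Hs. destruct (Classical_Prop.classic (exists t, E t /\ s < t))
      as [(t & [Ht1 Ht2] & Hst)|N].
    - apply Ht2. lra.
    - exfalso. assert (T <= s); [|lra]. apply HT2. intros t Ht.
      apply Rnot_lt_le. intros Hst. apply N. now exists t. }
  assert (HT : locally' (g T) (fun z => f z = RtoC 0)).
  { destruct (Req_dec T 0) as [->|HTn]; [apply E0; lra|].
    apply meromorphic_zero_limit; [exact Hf|]. intros eps Heps.
    set (d := Rmin T (eps / (2 * L))).
    assert (Hd : 0 < d <= T /\ d <= eps / (2 * L)).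
    { unfold d. repeat split; [|apply Rmin_l|apply Rmin_r].
      apply Rmin_glb_lt; [lra|]. apply Rdiv_lt_0_compat; lra. }
    exists (g (T - d)). split; [|apply Hbelow; lra].
    eapply Rle_lt_trans; [apply Hg|].
    replace (T - d - T) with (- d) by ring. rewrite Rabs_Ropp, Rabs_pos_eq by lra.
    apply Rle_lt_trans with (eps / (2 * L) * L); [apply Rmult_le_compat_r; lra|].
    replace (eps / (2 * L) * L) with (eps / 2) by (field; lra). lra. }
  destruct (Rle_lt_or_eq_dec T 1 (proj2 T0)) as [HT3|HT3].
  - exfalso. apply locally'_C in HT as (e & He & HT).
    set (d := Rmin (1 - T) (e / (2 * L))).
    assert (Hd : 0 < d <= 1 - T /\ d <= e / (2 * L)).
    { unfold d. repeat split; [|apply Rmin_l|apply Rmin_r].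
      apply Rmin_glb_lt; [lra|]. apply Rdiv_lt_0_compat; lra. }
    assert (T + d <= T); [|lra]. apply HT1. split; [lra|]. intros s Hs.
    destruct (Rlt_le_dec s T) as [HsT|HsT]; [apply Hbelow; lra|].
    apply (meromorphic_zero_nearby f (g T) (g s) e Hf HT).
    eapply Rle_lt_trans; [apply Hg|]. rewrite Rabs_pos_eq by lra.
    apply Rle_lt_trans with (e / (2 * L) * L); [apply Rmult_le_compat_r; lra|].
    replace (e / (2 * L) * L) with (e / 2) by (field; lra). lra.
  - rewrite HT3 in HT. unfold g in HT.
    now replace (p + RtoC 1 * (q - p))%C with q in HT by ring.
Qed.

Lemma mero_eq_of_half_plane (f g : C -> C) (sigma : R) :
  meromorphic f -> meromorphic g ->
  (forall s : C, sigma < Re s -> f s = g s) -> mero_eq f g.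
Proof.
  intros Hf Hg H z0.
  assert (K : locally' z0 (fun z => (f z - g z)%C = RtoC 0)).
  { apply (meromorphic_identity _ (RtoC (sigma + 2)) z0); [now apply meromorphic_minus|].
    apply locally'_C. exists 1; split; [lra|]. intros z _ Hz. rewrite H; [ring|].
    pose proof (re_le_Cmod (z - RtoC (sigma + 2))) as Hre.
    replace (Re (z - RtoC (sigma + 2))%C) with (Re z - (sigma + 2)) in Hre
      by (destruct z; simpl; ring).
    pose proof (Rabs_def2 (Re z - (sigma + 2)) 1). lra. }
  revert K. apply filter_imp. intros z Hz.
  replace (f z) with (g z + (f z - g z))%C by ring. rewrite Hz. ring.
Qed.

(** * Dirichlet series *)

Lemma is_series_C_drop_zeros (b : nat -> C) (l : C) (m : nat) :
  Cseries b l -> (forall k, (k < m)%nat -> b k = RtoC 0) ->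
  Cseries (fun k => b (m + k)%nat) l.
Proof.
  intros Hb Hz. destruct m as [|m]; [exact Hb|].
  apply (is_series_incr_n b (S m)); [lia|]. simpl pred.
  rewrite (sum_n_ext_loc b (fun _ => zero)) by (intros; apply Hz; lia).
  unfold sum_n. rewrite sum_n_m_const_zero, plus_zero_r. exact Hb.
Qed.

Lemma is_series_C_sum (F : nat -> nat -> C) (L : nat -> C) (n : nat) :
  (forall i, (1 <= i <= n)%nat -> Cseries (F i) (L i)) ->
  Cseries (fun j => @sum_n_m C_AbelianGroup (fun i => F i j) 1 n)
          (@sum_n_m C_AbelianGroup L 1 n).
Proof.
  induction n as [|n IH]; intros H.
  - apply filterlim_ext with (f := fun _ => zero : C).
    + intros N. symmetry. etransitivity; [|apply (@sum_n_m_const_zero C_AbelianMonoid 0 N)].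
      apply sum_n_m_ext. intros j. apply sum_n_m_zero; lia.
    + rewrite sum_n_m_zero by lia. apply filterlim_const.
  - rewrite sum_n_Sm by lia.
    eapply is_series_ext; [|apply (@is_series_plus C_AbsRing C_NormedModule);
      [apply IH; intros; apply H; lia|apply (H (S n)); lia]].
    intros j. symmetry. apply (@sum_n_Sm C_AbelianMonoid); lia.
Qed.

(** Pairing consecutive terms keeps the sum [l], since the paired partial sums are a subsequence of
    the original ones. Subtracting the odd-indexed terms leaves the even-indexed ones. *)
Lemma is_series_C_even_terms (a : nat -> C) (l l' : C) :
  Cseries a l -> Cseries (fun k => a (2 * k + 1)%nat) l' ->
  Cseries (fun k => a (2 * k)%nat) (l - l')%C.
Proof.
  intros Ha Hodd.
  assert (Hpair : Cseries (fun k => (a (2 * k)%nat + a (2 * k + 1)%nat)%C) l).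
  { unfold is_series. apply filterlim_ext with
      (f := fun N => @sum_n C_AbelianMonoid a (2 * N + 1)).
    - induction x as [|N IH].
      + simpl. rewrite sum_Sn, !sum_O. reflexivity.
      + replace (2 * S N + 1)%nat with (S (S (2 * N + 1))) by lia.
        rewrite !sum_Sn, IH. rewrite <- plus_assoc.
        replace (2 * S N)%nat with (S (2 * N + 1)) by lia.
        now replace (S (2 * N + 1) + 1)%nat with (S (S (2 * N + 1))) by lia.
    - apply (filterlim_comp _ _ _ (fun N => (2 * N + 1)%nat)
        (@sum_n C_AbelianMonoid a) _ eventually); [|exact Ha].
      apply eventually_subseq. intros; lia. }
  eapply is_series_ext;
    [|exact (@is_series_minus C_AbsRing C_NormedModule _ _ _ _ Hpair Hodd)].
  intros k. unfold plus, opp; simpl. ring.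
Qed.

Lemma cpow_Rpower (x r : R) : cpow x (RtoC r) = RtoC (Rpower x r).
Proof.
  unfold cpow. simpl. rewrite Rmult_0_l, cos_0, sin_0.
  apply injective_projections; simpl; ring.
Qed.

Lemma cpow_mult_base (x y : R) (s : C) :
  0 < x -> 0 < y -> cpow (x * y) s = (cpow x s * cpow y s)%C.
Proof.
  intros Hx Hy. unfold cpow. rewrite ln_mult by assumption.
  rewrite <- Rpower_mult_distr by assumption.
  rewrite Rmult_plus_distr_l, cos_plus, sin_plus.
  apply injective_projections; simpl; ring.
Qed.

Lemma cpow_add_nat (x : R) (s : C) (k : nat) :
  0 < x -> cpow x (s + RtoC (INR k))%C = (RtoC (x ^ k) * cpow x s)%C.
Proof.
  intros Hx. rewrite cpow_plus, cpow_Rpower, Rpower_pow by exact Hx. ring.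
Qed.

Lemma cpow_sub_1 (x : R) (s : C) :
  0 < x -> cpow x (s - RtoC 1)%C = (RtoC (/ x) * cpow x s)%C.
Proof.
  intros Hx. replace (s - RtoC 1)%C with (s + RtoC (- (1)))%C
    by (rewrite RtoC_opp; ring).
  rewrite cpow_plus, cpow_Rpower, Rpower_Ropp, Rpower_1 by exact Hx. ring.
Qed.

(** Index [j] carries the integer [j + 1], so odd integers sit at even indices. The even integers
    [2 (k + 1)] contribute [2^-w] times the full series. *)
Lemma is_series_odd_zeta (zeta : C -> C) (w : C) :
  is_riemann_zeta zeta -> 1 < Re w ->
  Cseries (fun k => cpow (2 * INR k + 1) (- w)%C) ((RtoC 1 - cpow 2 (- w)%C) * zeta w)%C.
Proof.
  intros [_ Hz] Hw. specialize (Hz w Hw).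
  replace ((RtoC 1 - cpow 2 (- w)%C) * zeta w)%C
    with (zeta w - cpow 2 (- w)%C * zeta w)%C by ring.
  eapply is_series_ext;
    [|apply (is_series_C_even_terms (fun j => cpow (INR (S j)) (- w)%C) (zeta w)
              (cpow 2 (- w) * zeta w)%C)].
  - intros k. cbv beta. f_equal. rewrite S_INR, mult_INR. simpl. ring.
  - exact Hz.
  - eapply is_series_ext; [|apply (@is_series_scal C_AbsRing C_NormedModule); exact Hz].
    intros k. cbv beta.
    replace (INR (S (2 * k + 1))) with (2 * INR (S k))
      by (rewrite !S_INR, plus_INR, mult_INR; simpl; ring).
    rewrite cpow_mult_base; [reflexivity|lra|apply lt_0_INR; lia].
Qed.

(** * Binomial coefficients and central factorial polynomials *)

Lemma Rprod_app (l1 l2 : list R) : Rprod (l1 ++ l2) = Rprod l1 * Rprod l2.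
Proof. induction l1 as [|x l1 IH]; simpl; [|rewrite IH]; ring. Qed.

Lemma Rprod_map_seq_S (f : nat -> R) (a r : nat) :
  Rprod (map f (seq a (S r))) = Rprod (map f (seq a r)) * f (a + r)%nat.
Proof.
  rewrite seq_S, map_app, Rprod_app. simpl. ring.
Qed.

Lemma Rprod_map_zero (f : nat -> R) (l : list nat) (i : nat) :
  In i l -> f i = 0 -> Rprod (map f l) = 0.
Proof.
  intros Hi Hf. induction l as [|x l IH]; simpl; [easy|].
  destruct Hi as [->|Hi]; [rewrite Hf|rewrite (IH Hi)]; ring.
Qed.

Definition odd_poly (r : nat) (x : R) : R :=
  Rprod (map (fun i => x - INR i ^ 2) (seq 0 r)).

(** The generating polynomial of [v (S r)] with its leading factor [x] removed. *)
Definition even_poly (r : nat) (x : R) : R :=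
  Rprod (map (fun i => x - (2 * INR i - 1) ^ 2) (seq 1 r)).

(** With [m = j + r + 1] the factors [(m - i) (m + i)] rearrange to [m * (j + 2) * ... * (j + 2 r)],
    which is [m * (j + 2 r)! / (j + 1)!]; the statement clears the denominator. *)
Lemma odd_poly_fact (r j : nat) :
  odd_poly r (INR (j + r + 1) ^ 2) * INR (j + 1) * INR (fact j)
  = INR (j + r + 1) * INR (fact (j + 2 * r)).
Proof.
  revert j. induction r as [|r IH]; intros j.
  - replace (j + 2 * 0)%nat with j by lia. replace (j + 0 + 1)%nat with (j + 1)%nat by lia.
    unfold odd_poly. simpl. ring.
  (* The pairs [(S r, j)] and [(r, S j)] have the same [m], so the two products differ by one factor
     only. *)
  - specialize (IH (S j)). unfold odd_poly in *. rewrite Rprod_map_seq_S.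
    replace (j + S r + 1)%nat with (S j + r + 1)%nat by lia.
    replace (j + 2 * S r)%nat with (S (S j + 2 * r)) by lia.
    rewrite !fact_simpl, !mult_INR in *.
    set (W := Rprod _) in *. set (F := INR (fact (S j + 2 * r))) in *.
    transitivity (INR (S (S j + 2 * r)) * (W * INR (S j + 1) * (INR (S j) * INR (fact j)))).
    + rewrite ?S_INR, ?plus_INR, ?S_INR, ?mult_INR. simpl. ring.
    + rewrite IH. ring.
Qed.

(** With [l = 2 (j + r + 1) + 1], each factor [l^2 - (2i - 1)^2] is
    [4 (j + r + 2 - i) (j + r + 1 + i)], and together they give
    [4^r * (j + 2 r + 1)! / (j + 1)!]. *)
Lemma even_poly_fact (r j : nat) :
  even_poly r ((2 * INR (j + r + 1) + 1) ^ 2) * (2 * INR (j + 1)) * INR (fact j)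
  = 2 * 4 ^ r * INR (fact (j + 2 * r + 1)).
Proof.
  revert j. induction r as [|r IH]; intros j.
  - replace (j + 2 * 0 + 1)%nat with (S j) by lia.
    unfold even_poly. rewrite fact_simpl, mult_INR, S_INR, !plus_INR. simpl. ring.
  - specialize (IH (S j)). unfold even_poly in *. rewrite Rprod_map_seq_S.
    replace (j + S r + 1)%nat with (S j + r + 1)%nat by lia.
    replace (j + 2 * S r + 1)%nat with (S (S j + 2 * r + 1)) by lia.
    rewrite (fact_simpl j), (fact_simpl (S j + 2 * r + 1)), !mult_INR in *.
    set (W := Rprod _) in *. set (F := INR (fact (S j + 2 * r + 1))) in *.
    transitivity (4 * INR (S (S j + 2 * r + 1))
      * (W * (2 * INR (S j + 1)) * (INR (S j) * INR (fact j)))).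
    + rewrite ?S_INR, ?plus_INR, ?S_INR, ?mult_INR. simpl. ring.
    + rewrite IH. simpl. ring.
Qed.

Lemma odd_binomial (r j : nat) :
  Binomial.C (j + 2 * r) j
  = / INR (fact (2 * r)) * (odd_poly r (INR (j + r + 1) ^ 2) * (1 - INR r / INR (j + r + 1))).
Proof.
  pose proof (odd_poly_fact r j) as H. unfold Binomial.C.
  replace (j + 2 * r - j)%nat with (2 * r)%nat by lia.
  assert (Hm : INR (j + r + 1) <> 0) by (apply not_0_INR; lia).
  pose proof (INR_fact_neq_0 j). pose proof (INR_fact_neq_0 (2 * r)).
  replace (1 - INR r / INR (j + r + 1)) with (INR (j + 1) / INR (j + r + 1))
    by (field_simplify_eq; [rewrite !plus_INR; ring|exact Hm]).
  replace (INR (fact (j + 2 * r)))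
    with (odd_poly r (INR (j + r + 1) ^ 2) * INR (j + 1) * INR (fact j) / INR (j + r + 1))
    by (rewrite H; field; exact Hm).
  field. auto.
Qed.

Lemma even_binomial (r j : nat) :
  Binomial.C (j + 2 * r + 1) j
  = / 4 ^ r / INR (fact (2 * r + 1)) *
    (even_poly r ((2 * INR (j + r + 1) + 1) ^ 2) * (2 * INR (j + r + 1) - 2 * INR r) / 2).
Proof.
  pose proof (even_poly_fact r j) as H. unfold Binomial.C.
  replace (j + 2 * r + 1 - j)%nat with (2 * r + 1)%nat by lia.
  assert (H4 : 4 ^ r <> 0) by (apply pow_nonzero; lra).
  pose proof (INR_fact_neq_0 j). pose proof (INR_fact_neq_0 (2 * r + 1)).
  replace (2 * INR (j + r + 1) - 2 * INR r) with (2 * INR (j + 1))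
    by (rewrite !plus_INR; ring).
  replace (INR (fact (j + 2 * r + 1)))
    with (even_poly r ((2 * INR (j + r + 1) + 1) ^ 2) * (2 * INR (j + 1)) * INR (fact j)
          / (2 * 4 ^ r))
    by (rewrite H; field; exact H4).
  field. auto.
Qed.

(** For [S k = r] the second factor vanishes; for smaller [S k] the product contains the factor with
    [i = S k]. *)
Lemma odd_poly_vanish (r k : nat) :
  (k < r)%nat -> odd_poly r (INR (S k) ^ 2) * (1 - INR r / INR (S k)) = 0.
Proof.
  intros Hk. destruct (Nat.eq_dec (S k) r) as [<-|Hne].
  - replace (1 - _) with 0; [ring|]. field. apply not_0_INR; lia.
  - unfold odd_poly. rewrite (Rprod_map_zero _ _ (S k)); [ring| |ring].
    apply in_seq. lia.
Qed.

Lemma even_poly_vanish (r k : nat) :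
  (k < S r)%nat -> even_poly r ((2 * INR k + 1) ^ 2) * (2 * INR k - 2 * INR r) = 0.
Proof.
  intros Hk. destruct (Nat.eq_dec k r) as [<-|Hne]; [ring|].
  unfold even_poly. rewrite (Rprod_map_zero _ _ (S k)); [ring| |].
  - apply in_seq. lia.
  - rewrite S_INR. ring.
Qed.

Lemma sum_u (u : nat -> nat -> R) (r : nat) (x : R) :
  is_central_factorial_u u ->
  sum_n_m (fun i => u r (i - 1)%nat * x ^ (i - 1)) 1 (S r) = odd_poly r x.
Proof.
  intros [H00 Hu]. rewrite <- sum_n_m_S.
  rewrite (sum_n_m_ext _ (fun k => u r k * x ^ k))
    by (intros k; now replace (S k - 1)%nat with k by lia).
  (* For [r = 0] the only term is [u 0 0 = 1], matching the empty product; for larger [r] the extra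
     term [u r 0] is 0. *)
  destruct r as [|r].
  - rewrite sum_n_n, H00. unfold odd_poly. simpl. ring.
  - destruct (Hu (S r) ltac:(lia)) as [Hu0 Hu1].
    rewrite (sum_n_m_Chasles _ 0 0 (S r)) by lia. rewrite sum_n_n, Hu0, Hu1.
    unfold plus; simpl. unfold odd_poly; simpl. ring.
Qed.

Lemma sum_v (v : nat -> nat -> R) (r : nat) (x : R) :
  is_central_factorial_v v -> x <> 0 ->
  sum_n_m (fun i => v (S r) i * x ^ (i - 1)) 1 (S r) = even_poly r x.
Proof.
  intros Hv Hx. specialize (Hv (S r) ltac:(lia) x).
  replace (S r - 1)%nat with r in Hv by lia. fold (even_poly r x) in Hv.
  apply (Rmult_eq_reg_l x); [|exact Hx]. rewrite <- Hv.
  etransitivity; [symmetry; apply (@sum_n_m_mult_l R_Ring)|].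
  apply sum_n_m_ext_loc. intros k Hk. unfold mult; simpl.
  replace k with (S (k - 1)) at 4 by lia. simpl. ring.
Qed.

Lemma sum_n_m_RtoC (a : nat -> R) (c : C) (p q : nat) :
  @sum_n_m C_AbelianGroup (fun i => (RtoC (a i) * c)%C) p q
  = (RtoC (sum_n_m a p q) * c)%C.
Proof.
  etransitivity; [apply (@sum_n_m_mult_r C_Ring)|].
  unfold mult; simpl. f_equal.
  destruct (Nat.le_gt_cases p q) as [Hpq|Hpq].
  - induction Hpq as [|q Hpq IH].
    + now rewrite !sum_n_n.
    + rewrite !sum_n_Sm by lia. rewrite IH. unfold plus; simpl. now rewrite RtoC_plus.
  - now rewrite !sum_n_m_zero.
Qed.

(** * Hemisphere zeta functions *)

Lemma Re_double_shift (s : C) (a b : R) :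
  Re (RtoC 2 * s - RtoC a + RtoC b)%C = 2 * Re s - a + b.
Proof. destruct s; simpl; ring. Qed.

Lemma double_shift_opp (s : C) (a b : R) (k : nat) :
  INR k = a - b ->
  (- (RtoC 2 * s - RtoC a + RtoC b) = - (RtoC 2 * s) + RtoC (INR k))%C.
Proof. intros ->. rewrite RtoC_minus. ring. Qed.

(** Each zeta value is expanded over all [m = S j]. The shifts of its argument multiply [m^(-2s)] by
    [(m^2)^(i-1)], with a further [1/m] for the second zeta value, and the finite sum over [i]
    collapses by [sum_u]. *)
Lemma is_series_odd_rhs (u : nat -> nat -> R) (zeta : C -> C) (r : nat) (s : C) :
  is_central_factorial_u u -> is_riemann_zeta zeta -> INR (S r) < Re s ->
  Cseries (fun j => (RtoC (/ INR (fact (2 * r)) *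
      (odd_poly r (INR (S j) ^ 2) * (1 - INR r / INR (S j))))
      * cpow (INR (S j)) (- (RtoC 2 * s)))%C)
    (odd_rhs u zeta (S r) s).
Proof.
  intros Hu [_ Hz] Hs. unfold odd_rhs.
  set (term := fun (i : nat) (j : nat) => (RtoC (ubar u (S r - 1) (i - 1)) *
     (cpow (INR (S j)) (- (RtoC 2 * s - RtoC (2 * INR i) + RtoC 2))
      - RtoC (INR (S r) - 1) * cpow (INR (S j)) (- (RtoC 2 * s - RtoC (2 * INR i) + RtoC 3))))%C).
  eapply is_series_ext; [|apply (@is_series_scal C_AbsRing C_NormedModule);
    apply (is_series_C_sum term)].
  - intros j. cbv beta.
    assert (Hj : 0 < INR (S j)) by (apply lt_0_INR; lia).
    set (m := INR (S j)) in *. set (c := cpow m (- (RtoC 2 * s))).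
    assert (Ht : forall i, (1 <= i <= S r)%nat -> term i j =
      (RtoC (2 / INR (fact (2 * r)) * (1 - INR r / m)
             * (u r (i - 1)%nat * (m ^ 2) ^ (i - 1))) * c)%C).
    { intros i Hi. unfold term. fold m.
      replace (- (RtoC 2 * s - RtoC (2 * INR i) + RtoC 2))%C
        with (- (RtoC 2 * s) + RtoC (INR (2 * (i - 1))))%C
        by (symmetry; apply double_shift_opp;
            rewrite ?S_INR, mult_INR, minus_INR by lia; simpl; ring).
      replace (- (RtoC 2 * s - RtoC (2 * INR i) + RtoC 3))%C
        with (- (RtoC 2 * s) + RtoC (INR (2 * (i - 1))) - RtoC 1)%C
        by (rewrite <- (double_shift_opp s (2 * INR i) 2)
              by (rewrite mult_INR, minus_INR by lia; simpl; ring); ring).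
      rewrite cpow_sub_1, cpow_add_nat by exact Hj. fold c. rewrite pow_mult.
      unfold ubar. replace (S r - 1)%nat with r by lia.
      replace (INR (S r) - 1) with (INR r) by (rewrite S_INR; ring).
      unfold Rdiv. repeat (rewrite ?RtoC_mult, ?RtoC_minus). ring. }
    rewrite (@sum_n_m_ext_loc C_AbelianGroup _ _ 1 (S r) Ht).
    rewrite sum_n_m_RtoC.
    rewrite (sum_n_m_mult_l (K := R_Ring) (2 / INR (fact (2 * r)) * (1 - INR r / m))
      (fun i => u r (i - 1)%nat * (m ^ 2) ^ (i - 1))).
    rewrite sum_u by exact Hu.
    unfold scal, mult; simpl. unfold mult; simpl.
    rewrite Cmult_assoc, <- RtoC_mult. f_equal. f_equal. field.
    split; [lra|apply INR_fact_neq_0].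
  - intros i Hi.
    assert (INR i <= INR (S r)) by (apply le_INR; lia).
    apply (@is_series_scal C_AbsRing C_NormedModule).
    apply (@is_series_minus C_AbsRing C_NormedModule).
    + apply Hz. rewrite Re_double_shift. lra.
    + apply (@is_series_scal C_AbsRing C_NormedModule). apply Hz.
      rewrite Re_double_shift. lra.
Qed.

(** The same expansion over odd integers [l = 2 k + 1]. The bound on [Re s] keeps even the smallest
    argument, [2 s - 2 i + 1], to the right of 1. *)
Lemma is_series_even_rhs (v : nat -> nat -> R) (zeta : C -> C) (r : nat) (s : C) :
  is_central_factorial_v v -> is_riemann_zeta zeta -> INR (S r) < Re s ->
  Cseries (fun k => (RtoC (/ 4 ^ r / INR (fact (2 * r + 1)) *
      (even_poly r ((2 * INR k + 1) ^ 2) * (2 * INR k - 2 * INR r) / 2))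
      * cpow (INR k + / 2) (- (RtoC 2 * s)))%C)
    (even_rhs v zeta (S r) s).
Proof.
  intros Hv Hz Hs. unfold even_rhs.
  set (c2 := cpow 2 (RtoC 2 * s - RtoC 1)).
  set (term := fun (i : nat) (k : nat) => (RtoC (vbar v (S r) i) * c2 *
     (cpow (2 * INR k + 1) (- (RtoC 2 * s - RtoC (2 * INR i) + RtoC 1))
      - RtoC (2 * INR (S r) - 1)
        * cpow (2 * INR k + 1) (- (RtoC 2 * s - RtoC (2 * INR i) + RtoC 2))))%C).
  eapply is_series_ext; [|apply (is_series_C_sum term)].
  - intros k. cbv beta. pose proof (pos_INR k) as Hk.
    set (l := 2 * INR k + 1). assert (Hl : 0 < l) by (unfold l; lra).
    replace (INR k + / 2) with (/ 2 * l) by (unfold l; field).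
    replace (2 * INR k - 2 * INR r) with (l - (2 * INR r + 1)) by (unfold l; ring).
    set (c := cpow l (- (RtoC 2 * s))).
    (* The hemisphere base is [l / 2], whence the factor [2^(2s) = 2 * c2]; the extra 2 cancels the
       division by 2 in the binomial formula. *)
    assert (Hc : cpow (/ 2 * l) (- (RtoC 2 * s)) = (RtoC 2 * c2 * c)%C).
    { rewrite cpow_mult_base by lra. fold c. unfold c2. f_equal.
      rewrite cpow_sub_1 by lra. rewrite Cmult_assoc, <- RtoC_mult, Rinv_r, Cmult_1_l by lra.
      rewrite !cpow_Cexp, ln_Rinv by lra. f_equal. rewrite RtoC_opp. ring. }
    rewrite Hc.
    assert (Ht : forall i, (1 <= i <= S r)%nat -> term i k =
      (RtoC (/ 4 ^ r / INR (fact (2 * r + 1)) * (l - (2 * INR r + 1))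
             * (v (S r) i * (l ^ 2) ^ (i - 1))) * (c2 * c))%C).
    { intros i Hi. unfold term. fold l.
      replace (- (RtoC 2 * s - RtoC (2 * INR i) + RtoC 2))%C
        with (- (RtoC 2 * s) + RtoC (INR (2 * (i - 1))))%C
        by (symmetry; apply double_shift_opp;
            rewrite ?S_INR, mult_INR, minus_INR by lia; simpl; ring).
      replace (- (RtoC 2 * s - RtoC (2 * INR i) + RtoC 1))%C
        with (- (RtoC 2 * s) + RtoC (INR (S (2 * (i - 1)))))%C
        by (symmetry; apply double_shift_opp;
            rewrite ?S_INR, mult_INR, minus_INR by lia; simpl; ring).
      rewrite !cpow_add_nat by exact Hl. fold c. rewrite <- tech_pow_Rmult, pow_mult.
      unfold vbar. replace (S r - 1)%nat with r by lia.
      replace (2 * S r - 1)%nat with (2 * r + 1)%nat by lia.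
      replace (2 * INR (S r) - 1) with (2 * INR r + 1) by (rewrite S_INR; ring).
      unfold Rdiv. repeat (rewrite ?RtoC_mult, ?RtoC_minus). ring. }
    rewrite (@sum_n_m_ext_loc C_AbelianGroup _ _ 1 (S r) Ht).
    rewrite sum_n_m_RtoC.
    rewrite (sum_n_m_mult_l (K := R_Ring)
      (/ 4 ^ r / INR (fact (2 * r + 1)) * (l - (2 * INR r + 1)))
      (fun i => v (S r) i * (l ^ 2) ^ (i - 1))).
    rewrite sum_v by (trivial; apply pow_nonzero; lra).
    unfold mult; simpl.
    replace (RtoC 2 * c2 * c)%C with (RtoC 2 * (c2 * c))%C by ring.
    rewrite (Cmult_assoc _ (RtoC 2)), <- RtoC_mult. f_equal. f_equal. field.
    split; [apply pow_nonzero; lra|apply INR_fact_neq_0].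
  - intros i Hi.
    assert (INR i <= INR (S r)) by (apply le_INR; lia).
    set (w1 := (RtoC 2 * s - RtoC (2 * INR i) + RtoC 1)%C).
    set (w2 := (RtoC 2 * s - RtoC (2 * INR i) + RtoC 2)%C).
    (* Multiplying [1 - 2^-w] by [2^(2s-1)] produces [2^(2s-1) - 2^(2s-1-w)], whose last exponent is
       [2 i - 2] for [w1] and [2 i - 3] for [w2]. *)
    assert (E : forall a w : C, (RtoC 2 * s - RtoC 1 - w)%C = a ->
      (c2 * ((RtoC 1 - cpow 2 (- w)) * zeta w) = (c2 - cpow 2 a) * zeta w)%C).
    { intros a w <-. unfold c2.
      replace (RtoC 2 * s - RtoC 1 - w)%C with (RtoC 2 * s - RtoC 1 + - w)%C by ring.
      rewrite cpow_plus. ring. }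
    rewrite <- Cmult_assoc, <- (E _ w1), <- (E _ w2)
      by (unfold w1, w2; rewrite !RtoC_minus; ring).
    evar_last.
    + apply (@is_series_scal C_AbsRing C_NormedModule (RtoC (vbar v (S r) i) * c2)%C).
      apply (@is_series_minus C_AbsRing C_NormedModule).
      * apply (is_series_odd_zeta zeta w1 Hz). unfold w1. rewrite Re_double_shift. lra.
      * apply (@is_series_scal C_AbsRing C_NormedModule (RtoC (2 * INR (S r) - 1))).
        apply (is_series_odd_zeta zeta w2 Hz). unfold w2. rewrite Re_double_shift. lra.
    + unfold scal, plus, opp; simpl. unfold mult; simpl. ring.
Qed.

Lemma is_series_hemisphere_odd (u : nat -> nat -> R) (zeta : C -> C) (n : nat) (s : C) :
  is_central_factorial_u u -> is_riemann_zeta zeta -> (1 <= n)%nat -> INR n < Re s ->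
  Cseries (fun j => hemisphere_term (2 * n - 1) (S j) s) (odd_rhs u zeta n s).
Proof.
  intros Hu Hz Hn Hs. destruct n as [|r]; [lia|].
  eapply is_series_ext;
    (* The vanishing terms are [m = 1, ..., r]; after dropping them, index [j] carries
       [m = j + r + 1]. *)
    [|apply (is_series_C_drop_zeros _ _ r (is_series_odd_rhs u zeta r s Hu Hz Hs))].
  - intros j. cbv beta. unfold hemisphere_term.
    replace (2 * S r - 1 + S j - 2)%nat with (j + 2 * r)%nat by lia.
    replace (S j - 1)%nat with j by lia.
    replace (INR (S j) + (INR (2 * S r - 1) - 1) / 2) with (INR (S (r + j))).
    + replace (S (r + j)) with (j + r + 1)%nat by lia. now rewrite <- odd_binomial.
    + replace (2 * S r - 1)%nat with (2 * r + 1)%nat by lia.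
      rewrite !S_INR, !plus_INR, mult_INR. simpl. field.
  - intros k Hk. cbv beta. rewrite odd_poly_vanish by exact Hk.
    rewrite Rmult_0_r. ring.
Qed.

Lemma is_series_hemisphere_even (v : nat -> nat -> R) (zeta : C -> C) (n : nat) (s : C) :
  is_central_factorial_v v -> is_riemann_zeta zeta -> (1 <= n)%nat -> INR n < Re s ->
  Cseries (fun j => hemisphere_term (2 * n) (S j) s) (even_rhs v zeta n s).
Proof.
  intros Hv Hz Hn Hs. destruct n as [|r]; [lia|].
  eapply is_series_ext;
    (* Here the count starts at [k = 0], so the vanishing terms [l = 1, 3, ..., 2 r + 1] are [S r]
       in number. *)
    [|apply (is_series_C_drop_zeros _ _ (S r) (is_series_even_rhs v zeta r s Hv Hz Hs))].
  - intros j. cbv beta. unfold hemisphere_term.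
    replace (2 * S r + S j - 2)%nat with (j + 2 * r + 1)%nat by lia.
    replace (S j - 1)%nat with j by lia.
    replace (INR (S j) + (INR (2 * S r) - 1) / 2) with (INR (S r + j) + / 2).
    + replace (S r + j)%nat with (j + r + 1)%nat by lia. now rewrite <- even_binomial.
    + rewrite plus_INR, mult_INR, !S_INR. simpl. field.
  - intros k Hk. cbv beta. rewrite even_poly_vanish by exact Hk.
    unfold Rdiv. rewrite Rmult_0_l, Rmult_0_r. ring.
Qed.

(** * Meromorphy of the right-hand sides and uniqueness of extensions *)

Lemma meromorphic_sum (F : nat -> C -> C) (n : nat) :
  (forall i, meromorphic (F i)) ->
  meromorphic (fun z => @sum_n_m C_AbelianGroup (fun i => F i z) 1 n).
Proof.
  intros HF. induction n as [|n IH].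
  - apply (meromorphic_ext (fun _ => zero)); [|apply meromorphic_const].
    intros z. symmetry. apply (@sum_n_m_zero C_AbelianMonoid); lia.
  - apply (meromorphic_ext
      (fun z => (@sum_n_m C_AbelianGroup (fun i => F i z) 1 n + F (S n) z)%C)).
    + intros z. symmetry. apply (@sum_n_Sm C_AbelianMonoid); lia.
    + now apply meromorphic_plus.
Qed.

Lemma meromorphic_double_shift (f : C -> C) (a b : C) :
  meromorphic f -> meromorphic (fun s => f (RtoC 2 * s - a + b)%C).
Proof.
  intros Hf. apply (meromorphic_ext (fun s => f (RtoC 2 * s + (b - a))%C)).
  - intros s. f_equal. ring.
  - apply meromorphic_affine; [|exact Hf]. intros E. apply RtoC_inj in E. lra.
Qed.

Lemma meromorphic_odd_rhs (u : nat -> nat -> R) (zeta : C -> C) (n : nat) :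
  meromorphic zeta -> meromorphic (odd_rhs u zeta n).
Proof.
  intros Hz. unfold odd_rhs.
  apply meromorphic_mult; [apply meromorphic_const|]. apply meromorphic_sum. intros i.
  apply meromorphic_mult; [apply meromorphic_const|].
  apply meromorphic_minus; [|apply meromorphic_mult; [apply meromorphic_const|]];
    now apply meromorphic_double_shift.
Qed.

Lemma meromorphic_even_rhs (v : nat -> nat -> R) (zeta : C -> C) (n : nat) :
  meromorphic zeta -> meromorphic (even_rhs v zeta n).
Proof.
  intros Hz. unfold even_rhs. apply meromorphic_sum. intros i.
  assert (Hc : forall c : C, meromorphic (fun s => (cpow 2 (RtoC 2 * s - RtoC 1) - c)%C)).
  { intros c. apply meromorphic_minus; [|apply meromorphic_const].
    apply (meromorphic_affine (cpow 2) (RtoC 2) (- RtoC 1)%C).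
    - intros E. apply RtoC_inj in E. lra.
    - apply meromorphic_cpow. }
  apply meromorphic_mult; [apply meromorphic_const|].
  apply meromorphic_minus.
  - apply meromorphic_mult; [apply Hc|now apply meromorphic_double_shift].
  - apply meromorphic_mult; [|now apply meromorphic_double_shift].
    apply meromorphic_mult; [apply meromorphic_const|apply Hc].
Qed.

Lemma meromorphic_extension_unique (sigma tau : R) (a : nat -> C -> C) (f g : C -> C) :
  meromorphic_extension sigma a f -> meromorphic_extension tau a g -> mero_eq f g.
Proof.
  intros [Hf Sf] [Hg Sg]. apply (mero_eq_of_half_plane f g (Rmax sigma tau) Hf Hg).
  intros s Hs. pose proof (Rmax_l sigma tau). pose proof (Rmax_r sigma tau).
  apply (filterlim_locally_unique (F := eventually)
           (@sum_n C_AbelianMonoid (fun j => a (S j) s))); [apply Sf|apply Sg]; lra.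
Qed.

Theorem theorem3p1
  (u v : nat -> nat -> R)
  (hu : is_central_factorial_u u) (hv : is_central_factorial_v v)
  (zeta : C -> C) (hzeta : is_riemann_zeta zeta)
  (n : nat) (hn : (1 <= n)%nat) :
  ((exists Z : C -> C, is_hemisphere_zeta (2 * n - 1) Z) /\
   (forall Z : C -> C, is_hemisphere_zeta (2 * n - 1) Z ->
      mero_eq Z (odd_rhs u zeta n))) /\
  ((exists Z : C -> C, is_hemisphere_zeta (2 * n) Z) /\
   (forall Z : C -> C, is_hemisphere_zeta (2 * n) Z ->
      mero_eq Z (even_rhs v zeta n))).
Proof.
  (* Each right-hand side is itself an extension of the hemisphere series from [Re s > n]. This
     gives existence, and by uniqueness every other extension equals it. *)
  assert (Hodd : meromorphic_extension (INR n) (hemisphere_term (2 * n - 1)) (odd_rhs u zeta n)).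
  { split; [apply meromorphic_odd_rhs, hzeta|].
    intros s Hs. now apply is_series_hemisphere_odd. }
  assert (Heven : meromorphic_extension (INR n) (hemisphere_term (2 * n)) (even_rhs v zeta n)).
  { split; [apply meromorphic_even_rhs, hzeta|].
    intros s Hs. now apply is_series_hemisphere_even. }
  split; split.
  - now exists (odd_rhs u zeta n), (INR n).
  - intros Z [sigma HZ]. exact (meromorphic_extension_unique _ _ _ _ _ HZ Hodd).
  - now exists (even_rhs v zeta n), (INR n).
  - intros Z [sigma HZ]. exact (meromorphic_extension_unique _ _ _ _ _ HZ Heven).
Qed.
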